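(* Suppose $\alpha\beta\gamma\neq 0$. Let $A=A(\alpha,\beta,\gamma)$ and fix $\nu_1,\nu_2,\nu_3\in\Bbbk^\times$ such that $a\nu_1^2=b\nu_2^2=c\nu_3^2=-iabc$. (1) The linear maps $\psi_1,\psi_2,\psi_3:V\to V$ extend to $\Bbbk$-algebra automorphisms of $A(\alpha,\beta,\gamma)$. (2) There is an injective group homomorphism $H_4\to \mathrm{Aut}_{\mathrm{gr}}(A)$ given by $\varepsilon_1\mapsto \nu_1^{-1}\psi_1$ and $\varepsilon_2\mapsto\nu_2^{-1}\psi_2$. Under this map $\delta\mapsto\phi_i$, the automorphism that is multiplication by $i^n$ on the degree-$n$ component $A_n$. (3) The subgroup of $\mathrm{Aut}_{\mathrm{gr}}(A)$ generated by $\gamma_1:=(\nu_1^{-1}\psi_1)^2$, $\gamma_2:=(\nu_2^{-1}\psi_2)^2$ and $\gamma_3:=(\nu_3^{-1}\psi_3)^2$ is isomorphic to $\mathbb Z_2\times\mathbb Z_2$, and these automorphisms act on $(x_0,x_1,x_2,x_3)$ by $$\gamma_1:(x_0,x_1,x_2,x_3)\mapsto(x_0,x_1,-x_2,-x_3),\quad \gamma_2:(x_0,x_1,x_2,x_3)\mapsto(x_0,-x_1,x_2,-x_3),\quad \gamma_3:(x_0,x_1,x_2,x_3)\mapsto(x_0,-x_1,-x_2,x_3).$$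
   Context: $\Bbbk$ is a field of characteristic not $2$ containing a fixed square root $i$ of $-1$. The parameters $\alpha,\beta,\gamma\in\Bbbk$ are assumed to have square roots in $\Bbbk$; $a,b,c\in\Bbbk$ are fixed square roots of $\alpha,\beta,\gamma$ respectively. $V$ is the $4$-dimensional $\Bbbk$-vector space with basis $x_0,x_1,x_2,x_3$. Write $[x,y]=xy-yx$ and $\{x,y\}=xy+yx$. $A(\alpha,\beta,\gamma)$ is the free algebra $\Bbbk\langle x_0,x_1,x_2,x_3\rangle$ (graded with $\deg x_j=1$) modulo the six relations $$[x_0,x_1]=\alpha\{x_2,x_3\},\quad [x_0,x_2]=\beta\{x_3,x_1\},\quad [x_0,x_3]=\gamma\{x_1,x_2\},$$ $$\{x_0,x_1\}=[x_2,x_3],\quad \{x_0,x_2\}=[x_3,x_1],\quad \{x_0,x_3\}=[x_1,x_2].$$ $\mathrm{Aut}_{\mathrm{gr}}(A)$ is the group of graded $\Bbbk$-algebra automorphisms of $A$. The maps $\psi_j$ are the linear maps on $V$ given by $\psi_1:\ x_0\mapsto bc\,x_1,\ x_1\mapsto -i x_0,\ x_2\mapsto -ib\,x_3,\ x_3\mapsto -c\,x_2$; $\psi_2:\ x_0\mapsto ac\,x_2,\ x_1\mapsto -a x_3,\ x_2\mapsto -i x_0,\ x_3\mapsto -ic\,x_1$; $\psi_3:\ x_0\mapsto ab\,x_3,\ x_1\mapsto -ia\,x_2,\ x_2\mapsto -b x_1,\ x_3\mapsto -i x_0$. The Heisenberg group of order $4^3$ is $H_4=\langle \varepsilon_1,\varepsilon_2,\delta\mid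 \varepsilon_1^4=\varepsilon_2^4=\delta^4=1,\ \delta\varepsilon_1=\varepsilon_1\delta,\ \varepsilon_2\delta=\delta\varepsilon_2,\ \varepsilon_1\varepsilon_2=\delta\varepsilon_2\varepsilon_1\rangle$. *)

(* Defs.v *)
From HB Require Import structures.
From mathcomp Require Import all_boot all_order all_algebra.
From mathcomp Require Import boolp finmap monalg.

Set Implicit Arguments.
Unset Strict Implicit.
Unset Printing Implicit Defensive.

Import GRing.Theory.
Local Open Scope ring_scope.
Local Open Scope quotient_scope.

Lemma malg_scalerAr (K : monomType) (R : comNzRingType) (c : R)
  (p q : {malg R[K]}) : c *: (p * q) = p * (c *: q).
Proof.
apply/malgP => m; rewrite mcoeffZ mcoeffMl mulr_sumr.
rewrite (mcoeffMlw _ (fsubset_refl _) (msuppZ_le c q)).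
apply: eq_bigr => u _; rewrite mulr_sumr; apply: eq_bigr => v _.
by rewrite mcoeffZ mulrnAr mulrCA.
Qed.

Definition j0 : 'I_4 := @Ordinal 4 0 isT.
Definition j1 : 'I_4 := @Ordinal 4 1 isT.
Definition j2 : 'I_4 := @Ordinal 4 2 isT.
Definition j3 : 'I_4 := @Ordinal 4 3 isT.

Section FreeAlgebra.
Variables (k : fieldType) (n : nat).

Definition free_alg : Type := {malg k[{fmonom 'I_n}]}.

HB.instance Definition _ := GRing.Lalgebra.on free_alg.

HB.instance Definition _ :=
  GRing.Lalgebra_isAlgebra.Build k free_alg (@malg_scalerAr _ k).

Definition free_gen (j : 'I_n) : free_alg := << fmu j >>.

Definition free_homog (d : nat) (p : free_alg) : Prop :=
  forall w : {fmonom 'I_n}, w \in msupp p -> fdeg w = d.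

Definition free_eps (p : free_alg) : k := mcoeff mone p.

Lemma free_eps_is_zmod_morphism : zmod_morphism free_eps.
Proof. by move=> p q; exact: mcoeffB. Qed.
Lemma free_eps_is_monoid_morphism : GRing.monoid_morphism free_eps.
Proof. by have [h1 h2] := mcoeff1g_is_multiplicative {fmonom 'I_n} k; split. Qed.
HB.instance Definition _ :=
  GRing.isZmodMorphism.Build free_alg k free_eps free_eps_is_zmod_morphism.
HB.instance Definition _ :=
  GRing.isMonoidMorphism.Build free_alg k free_eps free_eps_is_monoid_morphism.

Lemma free_eps_gen j : free_eps (free_gen j) = 0.
Proof. by rewrite /free_eps mcoeffU1 fmP fm1 fmU. Qed.

End FreeAlgebra.

Section Ideal.
Variables (R : nzRingType) (rs : seq R).

(* the two-sided ideal generated by rs: finite sums of u * r * v, r in rs *)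
Definition in_ideal (p : R) : Prop :=
  exists2 s : seq (R * R * R),
    all (fun t => t.1.2 \in rs) s & p = \sum_(t <- s) t.1.1 * t.1.2 * t.2.

Definition ideal_gen : {pred R} := fun p => `[< in_ideal p >].

Lemma ideal_gen_zmod : zmod_closed ideal_gen.
Proof.
split; first by apply/asboolP; exists [::] => //; rewrite big_nil.
move=> p q /asboolP[s hs ->] /asboolP[t ht ->]; apply/asboolP.
exists (s ++ [seq (- u.1.1, u.1.2, u.2) | u <- t]).
  by rewrite all_cat hs all_map.
rewrite big_cat big_map /=; congr (_ + _); rewrite -sumrN.
by apply: eq_bigr => u _; rewrite !mulNr.
Qed.

HB.instance Definition _ := GRing.isZmodClosed.Build R ideal_gen ideal_gen_zmod.

Lemma ideal_genMl p q : q \in ideal_gen -> p * q \in ideal_gen.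
Proof.
move=> /asboolP[s hs ->]; apply/asboolP.
exists [seq (p * u.1.1, u.1.2, u.2) | u <- s]; first by rewrite all_map.
by rewrite big_map mulr_sumr; apply: eq_bigr => u _; rewrite !mulrA.
Qed.

Lemma ideal_genMr p q : p \in ideal_gen -> p * q \in ideal_gen.
Proof.
move=> /asboolP[s hs ->]; apply/asboolP.
exists [seq (u.1.1, u.1.2, u.2 * q) | u <- s]; first by rewrite all_map.
by rewrite big_map mulr_suml; apply: eq_bigr => u _; rewrite !mulrA.
Qed.

Lemma ideal_gen_ker (S : nzRingType) (f : {rmorphism R -> S}) p :
  all (fun r => f r == 0) rs -> p \in ideal_gen -> f p = 0.
Proof.
move=> hf /asboolP[s hs ->]; rewrite raddf_sum big_seq big1 // => t.
move=> /(allP hs) /= /(allP hf) /= /eqP ht.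
by rewrite !rmorphM /= ht mulr0 mul0r.
Qed.

End Ideal.

(* algType structures are nontrivial rings, whence the hypothesis that the
   ideal is proper *)
Definition quot_alg (k : fieldType) (F : algType k) (rs : seq F)
  (rs1 : 1 \notin ideal_gen rs) : Type := Quotient.quot (ideal_gen rs).

Section QuotAlg.
Variables (k : fieldType) (F : algType k) (rs : seq F).
Hypothesis rs1 : 1 \notin ideal_gen rs.
Local Notation Q := (quot_alg rs1).

HB.instance Definition _ := GRing.Zmodule.on Q.
HB.instance Definition _ := EqQuotient.on Q.

Local Notation pi := (\pi_Q : F -> Q).

Lemma pi_eq (p q : F) : pi p = pi q <-> p - q \in ideal_gen rs.
Proof. by rewrite Quotient.idealrBE; split=> [->|/eqP]. Qed.

Definition qone : Q := lift_cst Q 1.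
Definition qmul : Q -> Q -> Q := lift_op2 Q *%R.
Definition qscale (c : k) : Q -> Q := lift_op1 Q ( *:%R c).

Lemma repr_ideal (p : F) : repr (pi p) - p \in ideal_gen rs.
Proof. by apply/pi_eq; rewrite reprK. Qed.

Lemma pi1E : pi 1 = qone.
Proof. by rewrite /qone; unlock. Qed.

Lemma piME p q : pi (p * q) = qmul (pi p) (pi q).
Proof.
unlock qmul; apply/esym/pi_eq; have -> : repr (pi p) * repr (pi q) - p * q =
  (repr (pi p) - p) * repr (pi q) + p * (repr (pi q) - q).
  by rewrite mulrBl mulrBr addrA subrK.
by apply: rpredD; [apply: ideal_genMr|apply: ideal_genMl]; exact: repr_ideal.
Qed.

Lemma piZE c p : pi (c *: p) = qscale c (pi p).
Proof.
unlock qscale; apply/esym/pi_eq; rewrite -scalerBr -mulr_algl.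
by apply: ideal_genMl; exact: repr_ideal.
Qed.

Lemma pi_add p q : pi (p + q) = pi p + pi q.
Proof. by rewrite !piE. Qed.

Lemma quot_alg_ind (P : Q -> Prop) : (forall p, P (pi p)) -> forall x, P x.
Proof. by move=> h x; rewrite -[x]reprK. Qed.

Lemma qmulA : associative qmul.
Proof.
elim/quot_alg_ind=> x; elim/quot_alg_ind=> y; elim/quot_alg_ind=> z.
by rewrite -!piME mulrA.
Qed.
Lemma qmul1 : left_id qone qmul.
Proof. by elim/quot_alg_ind=> x; rewrite -pi1E -piME mul1r. Qed.
Lemma qmulr1 : right_id qone qmul.
Proof. by elim/quot_alg_ind=> x; rewrite -pi1E -piME mulr1. Qed.
Lemma qmulDl : left_distributive qmul +%R.
Proof.
elim/quot_alg_ind=> x; elim/quot_alg_ind=> y; elim/quot_alg_ind=> z.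
by rewrite -pi_add -!piME -pi_add mulrDl.
Qed.
Lemma qmulDr : right_distributive qmul +%R.
Proof.
elim/quot_alg_ind=> x; elim/quot_alg_ind=> y; elim/quot_alg_ind=> z.
by rewrite -pi_add -!piME -pi_add mulrDr.
Qed.
Lemma qone_neq0 : qone != 0.
Proof.
rewrite -pi1E; apply/eqP; have -> : 0 = pi 0 by rewrite piE.
by move=> /pi_eq; rewrite subr0; apply/negP.
Qed.

HB.instance Definition _ := GRing.Zmodule_isNzRing.Build Q
  qmulA qmul1 qmulr1 qmulDl qmulDr qone_neq0.

Lemma qscaleA c d x : qscale c (qscale d x) = qscale (c * d) x.
Proof. by elim/quot_alg_ind: x => x; rewrite -!piZE scalerA. Qed.
Lemma qscale1 : left_id 1 qscale.
Proof. by elim/quot_alg_ind=> x; rewrite -piZE scale1r. Qed.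
Lemma qscaleDr : right_distributive qscale +%R.
Proof.
move=> c; elim/quot_alg_ind=> x; elim/quot_alg_ind=> y.
by rewrite -pi_add -!piZE -pi_add scalerDr.
Qed.
Lemma qscaleDl x : {morph qscale^~ x : c d / c + d}.
Proof.
by elim/quot_alg_ind: x => x c d; rewrite -!piZE -pi_add scalerDl.
Qed.

HB.instance Definition _ := GRing.Zmodule_isLmodule.Build k Q
  qscaleA qscale1 qscaleDr qscaleDl.

Lemma qscaleAl c (x y : Q) : c *: (x * y) = (c *: x) * y.
Proof.
elim/quot_alg_ind: x => x; elim/quot_alg_ind: y => y.
change (qscale c (qmul (pi x) (pi y)) = qmul (qscale c (pi x)) (pi y)).
by rewrite -piZE -!piME -piZE scalerAl.
Qed.

HB.instance Definition _ := GRing.Lmodule_isLalgebra.Build k Q qscaleAl.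

Lemma qscaleAr c (x y : Q) : c *: (x * y) = x * (c *: y).
Proof.
elim/quot_alg_ind: x => x; elim/quot_alg_ind: y => y.
change (qscale c (qmul (pi x) (pi y)) = qmul (pi x) (qscale c (pi y))).
by rewrite -piZE -!piME -piZE scalerAr.
Qed.

HB.instance Definition _ := GRing.Lalgebra_isAlgebra.Build k Q qscaleAr.

Definition quot_pi (p : F) : Q := pi p.

Lemma quot_pi_is_linear : linear quot_pi.
Proof. by move=> c p q; rewrite /quot_pi pi_add piZE. Qed.
Lemma quot_pi_is_monoid_morphism : GRing.monoid_morphism quot_pi.
Proof. by split=> [|p q]; rewrite /quot_pi ?pi1E ?piME. Qed.
HB.instance Definition _ :=
  GRing.isLinear.Build k F Q _ quot_pi quot_pi_is_linear.
HB.instance Definition _ :=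
  GRing.isMonoidMorphism.Build F Q quot_pi quot_pi_is_monoid_morphism.

End QuotAlg.

Section Relations.
Variables (k : fieldType) (F : algType k) (alpha beta gamma : k) (x : 'I_4 -> F).

Definition commr (u v : F) := u * v - v * u.
Definition acommr (u v : F) := u * v + v * u.

Definition relators : seq F :=
  [:: commr (x j0) (x j1) - alpha *: acommr (x j2) (x j3);
      commr (x j0) (x j2) - beta *: acommr (x j3) (x j1);
      commr (x j0) (x j3) - gamma *: acommr (x j1) (x j2);
      acommr (x j0) (x j1) - commr (x j2) (x j3);
      acommr (x j0) (x j2) - commr (x j3) (x j1);
      acommr (x j0) (x j3) - commr (x j1) (x j2)].

Lemma relators_proper (f : {rmorphism F -> k}) :
  (forall j, f (x j) = 0) -> 1 \notin ideal_gen relators.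
Proof.
move=> fx; apply/negP => /(ideal_gen_ker (f := f)) h.
suff /h/eqP : all (fun r => f r == 0) relators by rewrite rmorph1 oner_eq0.
have fc u v : f (commr (x u) (x v)) = 0.
  by rewrite rmorphB !rmorphM /= !fx !mul0r subr0.
have fa u v : f (acommr (x u) (x v)) = 0.
  by rewrite rmorphD !rmorphM /= !fx !mul0r addr0.
have f1 c u v : f u = 0 -> f v = 0 -> f (u - c *: v) == 0.
  by move=> fu fv; rewrite -mulr_algl rmorphB rmorphM fu fv mulr0 subr0.
have f2 u v : f u = 0 -> f v = 0 -> f (u - v) == 0.
  by move=> fu fv; rewrite rmorphB fu fv subr0.
by rewrite /relators /all; do !(apply/andP; split) => //;
  first [exact: f1 (fc _ _) (fa _ _) | exact: f2 (fa _ _) (fc _ _)].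
Qed.

End Relations.

Section AlgA.
Variables (k : fieldType) (alpha beta gamma : k).

Definition algA : Type := quot_alg
  (relators_proper alpha beta gamma (@free_eps_gen k 4)).

HB.instance Definition _ := GRing.Algebra.on algA.

Definition toA (p : free_alg k 4) : algA := quot_pi _ p.
HB.instance Definition _ := GRing.isLinear.Build k (free_alg k 4) algA _ toA
  (quot_pi_is_linear _).
HB.instance Definition _ := GRing.isMonoidMorphism.Build (free_alg k 4) algA toA
  (quot_pi_is_monoid_morphism _).

Definition xA (j : 'I_4) : algA := toA (free_gen k j).

(* degree-d component A_d *)
Definition homogA (d : nat) (u : algA) : Prop :=
  exists2 p, free_homog d p & u = toA p.

(* V = k^4 with basis x_j = xV j (delta_mx 0 j), mapped to A_1 *)
Definition VtoA (v : 'rV[k]_4) : algA := \sum_j v 0 j *: xA j.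

Definition alg_automorphism (f : algA -> algA) : Prop :=
  [/\ linear f, GRing.monoid_morphism f & bijective f].

(* for a bijective f this is f(A_d) = A_d for all d *)
Definition graded_map (f : algA -> algA) : Prop :=
  forall d u, homogA d u <-> homogA d (f u).

Definition gr_automorphism (f : algA -> algA) : Prop :=
  alg_automorphism f /\ graded_map f.

Definition aut_gr : Type :=
  {f : algA -> algA | `[< gr_automorphism f >]}.

HB.instance Definition _ := SubChoice.on aut_gr.

Definition mk_aut f (h : `[< gr_automorphism f >]) : aut_gr :=
  @exist _ (fun f => `[< gr_automorphism f >]) f h.

Definition aut_fun (f : aut_gr) : algA -> algA := val f.
Coercion aut_fun : aut_gr >-> Funclass.

Lemma aut_grP (f : aut_gr) : gr_automorphism f.
Proof. exact/asboolP/(valP f). Qed.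

Lemma aut_gr_ext (f g : aut_gr) : f =1 g -> f = g.
Proof. by move=> /funext fg; apply: val_inj. Qed.

Lemma aut_one_subproof : `[< gr_automorphism id >].
Proof. by apply/asboolP; do !split=> //; exists id. Qed.

Definition aut_one : aut_gr := mk_aut aut_one_subproof.

Lemma aut_mul_subproof (f g : aut_gr) :
  `[< gr_automorphism (f \o g) >].
Proof.
have [[fl [f1 fM] fb] fd] := aut_grP f; have [[gl [g1 gM] gb] gd] := aut_grP g.
apply/asboolP; split; last by move=> d u; rewrite gd fd.
split; last exact: bij_comp.
  by move=> c u v; rewrite /= gl fl.
by split=> [|u v]; rewrite /= ?g1 ?f1 // gM fM.
Qed.

(* product is composition: (f * g) u = f (g u) *)
Definition aut_mul (f g : aut_gr) : aut_gr := mk_aut (aut_mul_subproof f g).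

Lemma aut_inv_exists (f : aut_gr) :
  exists g : aut_gr, cancel f g /\ cancel g f.
Proof.
have [[fl [f1 fM] [g fK gK]] fd] := aut_grP f; have fi := can_inj fK.
suff h : `[< gr_automorphism g >] by exists (mk_aut h).
apply/asboolP; split; last by move=> d u; rewrite (fd d (g u)) gK.
split; last by exists f.
  by move=> c u v; apply: fi; rewrite fl !gK.
by split=> [|u v]; apply: fi; rewrite ?f1 ?fM !gK.
Qed.

Definition aut_inv (f : aut_gr) : aut_gr := sval (cid (aut_inv_exists f)).

Lemma aut_mulA : associative aut_mul.
Proof. by move=> f g h; apply: aut_gr_ext. Qed.
Lemma aut_mul1 : left_id aut_one aut_mul.
Proof. by move=> f; apply: aut_gr_ext. Qed.
Lemma aut_mulr1 : right_id aut_one aut_mul.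
Proof. by move=> f; apply: aut_gr_ext. Qed.
Lemma aut_mulVf : left_inverse aut_one aut_inv aut_mul.
Proof.
move=> f; apply: aut_gr_ext; rewrite /aut_inv.
by case: cid => g /= [fK _] u; exact: fK.
Qed.
Lemma aut_mulfV : right_inverse aut_one aut_inv aut_mul.
Proof.
move=> f; apply: aut_gr_ext; rewrite /aut_inv.
by case: cid => g /= [_ gK] u; exact: gK.
Qed.

HB.instance Definition _ := isGroup.Build aut_gr
  aut_mulA aut_mul1 aut_mulr1 aut_mulVf aut_mulfV.

Lemma aut_grM (f g : aut_gr) u : ((f * g)%g : aut_gr) u = f (g u).
Proof. by []. Qed.

(* f restricts to psi on V = A_1 *)
Definition extends (psi : 'End('rV[k]_4)) (f : algA -> algA) : Prop :=
  forall v, f (VtoA v) = VtoA (psi v).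

(* f is the automorphism phi_lam: multiplication by lam^d on each A_d *)
Definition is_phi (lam : k) (f : aut_gr) : Prop :=
  forall d u, homogA d u -> f u = lam ^+ d *: u.

End AlgA.

Section LinearMaps.
Variable k : fieldType.
Local Notation V := 'rV[k]_4.

Definition xV (j : 'I_4) : V := delta_mx 0 j.

Definition linext_fun (y : 'I_4 -> V) (v : V) : V := \sum_j v 0 j *: y j.

Lemma linext_is_linear y : linear (linext_fun y).
Proof.
move=> c u v; rewrite /linext_fun scaler_sumr -big_split.
by apply: eq_bigr => j _; rewrite !mxE scalerDl scalerA.
Qed.
HB.instance Definition _ y :=
  GRing.isLinear.Build k V V _ (linext_fun y) (linext_is_linear y).

(* x_j |-> y_j, see linext_xV *)
Definition linext (y : 'I_4 -> V) : 'End(V) := linfun (linext_fun y).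

Lemma linext_xV y j : linext y (xV j) = y j.
Proof.
rewrite lfunE /= /linext_fun (bigD1 j) //= big1 ?mxE ?eqxx ?scale1r ?addr0 //.
by move=> l nlj; rewrite mxE (negbTE nlj) andbF scale0r.
Qed.

Definition psi1 (i b c : k) : 'End(V) := linext (fun j =>
  [:: (b * c) *: xV j1; - i *: xV j0; - (i * b) *: xV j3; - c *: xV j2]`_j).

Definition psi2 (i a c : k) : 'End(V) := linext (fun j =>
  [:: (a * c) *: xV j2; - a *: xV j3; - i *: xV j0; - (i * c) *: xV j1]`_j).

Definition psi3 (i a b : k) : 'End(V) := linext (fun j =>
  [:: (a * b) *: xV j3; - (i * a) *: xV j2; - b *: xV j1; - i *: xV j0]`_j).

End LinearMaps.

Lemma VtoA_xV (k : fieldType) (al be ga : k) j :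
  VtoA al be ga (xV k j) = xA al be ga j.
Proof.
rewrite /VtoA (bigD1 j) //= big1 ?mxE ?eqxx ?scale1r ?addr0 //.
by move=> l nlj; rewrite mxE (negbTE nlj) andbF scale0r.
Qed.

Section PresentedGroup.
Variables (n : nat).

(* (false, g) is the generator g and (true, g) its formal inverse *)
Definition word := seq (bool * 'I_n).

Definition word_gen (g : 'I_n) : word := [:: (false, g)].
Definition word_exp (w : word) (m : nat) : word := flatten (nseq m w).
Definition word_inv (w : word) : word := rev [seq (~~ l.1, l.2) | l <- w].

Variable rels : seq (word * word).

(* the smallest congruence making formal inverses inverse to the generators
   and identifying both sides of each relation *)
Inductive word_cong : word -> word -> Prop :=
| wc_rel u v : (u, v) \in rels -> word_cong u v
| wc_cancel e g : word_cong [:: (e, g); (~~ e, g)] [::]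
| wc_cat u u' v v' :
    word_cong u u' -> word_cong v v' -> word_cong (u ++ v) (u' ++ v')
| wc_refl u : word_cong u u
| wc_sym u v : word_cong u v -> word_cong v u
| wc_trans u v w : word_cong u v -> word_cong v w -> word_cong u w.

Definition word_congb (u v : word) : bool := `[< word_cong u v >].

Lemma word_congb_equiv : equiv_class_of word_congb.
Proof.
split.
- by move=> u; apply/asboolP; exact: wc_refl.
- by move=> u v; apply/asboolP/asboolP; exact: wc_sym.
- move=> v u w /asboolP uv /asboolP vw; apply/asboolP; exact: wc_trans uv vw.
Qed.

Canonical word_equiv := EquivRelPack word_congb_equiv.
Canonical word_encModRel := defaultEncModRel word_congb.

Definition pres_group : Type := {eq_quot word_congb}.
HB.instance Definition _ := Choice.on pres_group.
HB.instance Definition _ := EqQuotient.on pres_group.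

Definition pres_pi (w : word) : pres_group := \pi_pres_group w.
Definition pres_gen (g : 'I_n) : pres_group := pres_pi (word_gen g).

Lemma pres_pi_eq u v : pres_pi u = pres_pi v <-> word_cong u v.
Proof. by split=> [/eqmodP /asboolP|h] //; apply/eqmodP/asboolP. Qed.

Lemma repr_pres u : word_cong (repr (pres_pi u)) u.
Proof. by apply/pres_pi_eq; rewrite /pres_pi reprK. Qed.

Lemma pres_group_ind (P : pres_group -> Prop) :
  (forall w, P (pres_pi w)) -> forall x, P x.
Proof. by move=> h x; rewrite -[x]reprK; apply: h. Qed.

Lemma word_invl u : word_cong (word_inv u ++ u) [::].
Proof.
elim: u => [|[e g] w IH]; first exact: wc_refl.
rewrite /word_inv /= rev_cons -cats1 -catA /=.
apply: wc_trans IH; apply: wc_cat; first exact: wc_refl.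
have h := wc_cancel (~~ e) g; rewrite negbK in h.
exact: (wc_cat h (wc_refl w)).
Qed.

Lemma word_invr u : word_cong (u ++ word_inv u) [::].
Proof.
have := word_invl (word_inv u); rewrite {1}/word_inv map_rev revK -map_comp.
by rewrite (eq_map (g := id)) ?map_id // => -[e g] /=; rewrite negbK.
Qed.

Lemma word_inv_cong u v : word_cong u v -> word_cong (word_inv u) (word_inv v).
Proof.
move=> uv; apply: wc_trans (_ : word_cong (word_inv u ++ v ++ word_inv v) _).
  rewrite -{1}[word_inv u]cats0; apply: wc_cat; first exact: wc_refl.
  exact/wc_sym/word_invr.
rewrite catA -[X in word_cong _ X]cat0s; apply: wc_cat; last exact: wc_refl.
by apply: wc_trans (word_invl u); apply: wc_cat; [exact: wc_refl|exact: wc_sym].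
Qed.

Definition pres_one : pres_group := pres_pi [::].
Definition pres_mul (x y : pres_group) : pres_group := pres_pi (repr x ++ repr y).
Definition pres_inv (x : pres_group) : pres_group := pres_pi (word_inv (repr x)).

Lemma pres_piM u v : pres_pi (u ++ v) = pres_mul (pres_pi u) (pres_pi v).
Proof. by apply/pres_pi_eq/wc_sym/wc_cat; apply: repr_pres. Qed.

Lemma pres_piV u : pres_pi (word_inv u) = pres_inv (pres_pi u).
Proof. by apply/pres_pi_eq/wc_sym/word_inv_cong/repr_pres. Qed.

Lemma pres_mulA : associative pres_mul.
Proof.
elim/pres_group_ind=> u; elim/pres_group_ind=> v; elim/pres_group_ind=> w.
by rewrite -!pres_piM catA.
Qed.
Lemma pres_mul1 : left_id pres_one pres_mul.
Proof. by elim/pres_group_ind=> u; rewrite -pres_piM. Qed.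
Lemma pres_mulr1 : right_id pres_one pres_mul.
Proof. by elim/pres_group_ind=> u; rewrite -pres_piM cats0. Qed.
Lemma pres_mulVx : left_inverse pres_one pres_inv pres_mul.
Proof.
elim/pres_group_ind=> u; rewrite -pres_piV -pres_piM.
exact/pres_pi_eq/word_invl.
Qed.
Lemma pres_mulxV : right_inverse pres_one pres_inv pres_mul.
Proof.
elim/pres_group_ind=> u; rewrite -pres_piV -pres_piM.
exact/pres_pi_eq/word_invr.
Qed.

HB.instance Definition _ := isGroup.Build pres_group
  pres_mulA pres_mul1 pres_mulr1 pres_mulVx pres_mulxV.

End PresentedGroup.

Section Heisenberg.

Let e1 : word 3 := word_gen 0.
Let e2 : word 3 := word_gen 1.
Let d : word 3 := word_gen 2.

Definition H4_rels : seq (word 3 * word 3) :=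
  [:: (word_exp e1 4, [::]); (word_exp e2 4, [::]); (word_exp d 4, [::]);
      (d ++ e1, e1 ++ d); (e2 ++ d, d ++ e2); (e1 ++ e2, d ++ e2 ++ e1)].

Definition H4 : Type := pres_group H4_rels.
HB.instance Definition _ := Group.on H4.

Definition H4_eps1 : H4 := pres_gen _ 0.
Definition H4_eps2 : H4 := pres_gen _ 1.
Definition H4_delta : H4 := pres_gen _ 2.

End Heisenberg.

(* the intersection of all subgroups containing S; classically every subgroup
   is given by a boolean groupClosed predicate *)
Definition in_generated (G : groupType) (S : seq G) (x : G) : Prop :=
  forall H : groupClosed G, {subset S <= H} -> x \in H.

(* Main.v *)
From HB Require Import structures.
Require Import Defs.
From mathcomp Require Import all_boot all_order all_algebra.
From mathcomp Require Import boolp finmap monalg ring.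

Import GRing.Theory.
Local Open Scope ring_scope.

Set Implicit Arguments.
Unset Strict Implicit.
Unset Printing Implicit Defensive.

(** The relators of [A] are homogeneous of degree 2, so a linear map on [V]
    extends to a graded endomorphism of [A] as soon as the images of the [x_j]
    satisfy the six relations ([algA_lift], [graded_endomorphism]), and the
    extension is unique because the [x_j] generate [A] ([algA_ext]).

    The map [psi_1] carries each of the six relations to a scalar multiple of
    one of them ([relations_twist]).  The relations are invariant under the
    simultaneous cyclic rotation of [x_1, x_2, x_3] and of
    [alpha, beta, gamma] ([relations_rot]), and this rotation carries [psi_1]
    to [psi_2] and [psi_2] to [psi_3], so that a single computation settles
    the three maps; the predicate [twist] records their common shape.

    The condition on [nu_j] makes the square of [nu_j^-1 psi_j] diagonal with
    entries 1 and -1 ([twist_square]).  Hence [nu_j^-1 psi_j] has order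
    dividing 4 and its cube provides the inverse of its extension
    ([graded_extension]).  Composing with the scaling automorphism
    [phi_{nu_j}] gives the extension of [psi_j] itself
    ([unscale_extension]), which is (1).

    For (2), the relations of [H_4] hold for [nu_1^-1 psi_1], [nu_2^-1
    psi_2] and [phi_i]; the only one that needs a further computation is the
    commutation of the first two up to [i] ([psi12_commutation]). Every
    element of [H_4] is [e1^p e2^q d^r], and its commutators with [e2] and
    [e1] are [d^p] and [d^q] up to inversion; so a kernel containing no
    nontrivial power of [d] is trivial, and injectivity reduces to [phi_i^2
    = phi_{-1}] being nontrivial ([H4_injective]). This holds since the
    characteristic is not 2 and [x_0 <> 0] in [A], as a square-zero
    representation shows ([xA_neq0]).

    For (3), the three squares are diagonal with entries 1 and -1, and the
    third is the product of the first two ([sign_automorphisms]); two distinct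
    commuting involutions generate a Klein group ([klein_subgroup]). *)

(** * Evaluation of noncommutative polynomials *)

Section UniversalProperty.
Variables (k : fieldType) (n : nat) (S : algType k) (y : 'I_n -> S).

Definition fmonom_eval (w : {fmonom 'I_n}) : S := \prod_(j <- w) y j.

Lemma fmonom_eval_mmorphism : mmorphism fmonom_eval.
Proof.
split=> [u v|]; first by rewrite /fmonom_eval fmM big_cat.
by rewrite /fmonom_eval fm1 big_nil.
Qed.

HB.instance Definition _ :=
  monalg.isMultiplicative.Build {fmonom 'I_n} S fmonom_eval
    fmonom_eval_mmorphism.

Definition free_eval (p : free_alg k n) : S := mmap (in_alg S) fmonom_eval p.

Lemma free_eval_linear : linear free_eval.
Proof.
move=> c p q; rewrite /free_eval mmapD mmapZ /=.
by rewrite -scalerAl mul1r.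
Qed.

Lemma free_eval_monoid_morphism : GRing.monoid_morphism free_eval.
Proof.
have hc (g : {malg k[{fmonom 'I_n}]}) (m m' : {fmonom 'I_n}) :
    GRing.comm (in_alg S g@_m) (fmonom_eval m').
  by rewrite /GRing.comm /= -scalerAl -scalerAr mul1r mulr1.
by have [h1 h2] := commr_mmap_is_multiplicative hc; split.
Qed.

HB.instance Definition _ :=
  GRing.isLinear.Build k (free_alg k n) S _ free_eval free_eval_linear.
HB.instance Definition _ :=
  GRing.isMonoidMorphism.Build (free_alg k n) S free_eval
    free_eval_monoid_morphism.

Lemma free_eval_gen j : free_eval (free_gen k j) = y j.
Proof.
by rewrite /free_eval /free_gen mmapU /= /fmonom_eval scale1r mul1r fmU big_seq1.
Qed.

End UniversalProperty.

Lemma free_alg_monomE (k : fieldType) n (w : {fmonom 'I_n}) :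
  (<< w >> : free_alg k n) = \prod_(j <- w) free_gen k j.
Proof.
case: w => s; elim: s => [|j s IHs] /=.
  by rewrite big_nil; congr (<< _ >>); apply/eqP; rewrite fmP fm1.
rewrite big_cons -IHs /free_gen /=.
rewrite -[RHS]/(fgmul _ _) fgmulUU mulr1; congr (<< _ >>).
by apply/eqP; rewrite fmP fmM fmU.
Qed.

(** * The grading and the universal property of A *)

Section HomogeneousFree.
Variables (k : fieldType) (n : nat).
Implicit Types (p q : free_alg k n).

Lemma free_homog0 d : free_homog d (0 : free_alg k n).
Proof. by move=> w; rewrite msupp0 inE. Qed.

Lemma free_homogD d p q :
  free_homog d p -> free_homog d q -> free_homog d (p + q).
Proof.
move=> hp hq w /(fsubsetP (msuppD_le _ _)); rewrite inE => /orP[/hp|/hq] //.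
Qed.

Lemma free_homogZ d c p : free_homog d p -> free_homog d (c *: p).
Proof. by move=> hp w /(fsubsetP (msuppZ_le _ _)) /hp. Qed.

Lemma free_homog1 : free_homog 0 (1 : free_alg k n).
Proof.
by move=> w; rewrite -[1]/(<< mone >>) msuppU1 inE => /eqP->; rewrite fdeg1.
Qed.

Lemma free_homog_gen j : free_homog 1 (free_gen k (n := n) j).
Proof. by move=> w; rewrite msuppU1 inE => /eqP->; rewrite fdegU. Qed.

Lemma free_homogM d e p q :
  free_homog d p -> free_homog e q -> free_homog (d + e) (p * q).
Proof.
move=> hp hq w /msuppM_le[u [v [/hp <- /hq <- ->]]].
by rewrite fdegM.
Qed.

End HomogeneousFree.

Section RelatorsMorphism.
Variables (k : fieldType) (F S : algType k) (f : {lrmorphism F -> S}).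

Lemma lrmorph_commr u v : f (commr u v) = commr (f u) (f v).
Proof. by rewrite /commr rmorphB !rmorphM. Qed.

Lemma lrmorph_acommr u v : f (acommr u v) = acommr (f u) (f v).
Proof. by rewrite /acommr rmorphD !rmorphM. Qed.

Lemma lrmorph_relators al be ga (x : 'I_4 -> F) :
  map f (relators al be ga x) = relators al be ga (f \o x).
Proof.
have h1 c u v w z :
    f (commr u v - c *: acommr w z) = commr (f u) (f v) - c *: acommr (f w) (f z).
  by rewrite linearB linearZ /= lrmorph_commr lrmorph_acommr.
have h2 u v w z :
    f (acommr u v - commr w z) = acommr (f u) (f v) - commr (f w) (f z).
  by rewrite linearB /= lrmorph_commr lrmorph_acommr.
by rewrite /relators [LHS]/= !h1 !h2.
Qed.

End RelatorsMorphism.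

Section AlgebraA.
Variables (k : fieldType) (al be ga : k).
Local Notation A := (algA al be ga).
Local Notation x := (xA al be ga).
Local Notation homog := (@homogA k al be ga).

Lemma homogA0 d : homog d 0.
Proof. by exists 0; [exact: free_homog0 | rewrite linear0]. Qed.

Lemma homogAD d u v : homog d u -> homog d v -> homog d (u + v).
Proof.
move=> [p hp ->] [q hq ->]; exists (p + q); first exact: free_homogD.
by rewrite linearD.
Qed.

Lemma homogAZ d c u : homog d u -> homog d (c *: u).
Proof.
move=> [p hp ->]; exists (c *: p); first exact: free_homogZ.
by rewrite linearZ.
Qed.

Lemma homogAM d e u v : homog d u -> homog e v -> homog (d + e) (u * v).
Proof.
move=> [p hp ->] [q hq ->]; exists (p * q); first exact: free_homogM.
by rewrite rmorphM.
Qed.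

Lemma homogA_prod (y : 'I_4 -> A) (s : seq 'I_4) :
  (forall j, homog 1 (y j)) -> homog (size s) (\prod_(j <- s) y j).
Proof.
move=> hy; elim: s => [|j s IHs].
  by rewrite big_nil; exists 1; [exact: free_homog1 | rewrite rmorph1].
by rewrite big_cons; apply: homogAM (hy j) IHs.
Qed.

Lemma homogA_V (v : 'rV[k]_4) : homog 1 (VtoA al be ga v).
Proof.
rewrite /VtoA; apply: (big_ind (homog 1)) => [|u w|j _].
- exact: homogA0.
- exact: homogAD.
- by apply/homogAZ; exists (free_gen k j); first exact: free_homog_gen.
Qed.

(** The monomials in the [x_j] span [A]; keeping track of the support of [p]
    makes the same argument serve for all of [A] and for each [A_d]. *)
Lemma toA_span (P : A -> Prop) (p : free_alg k 4) :
  P 0 -> (forall c u v, P u -> P v -> P (c *: u + v)) ->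
  (forall w, w \in msupp p -> P (\prod_(j <- w) x j)) -> P (toA al be ga p).
Proof.
move=> P0 PD Pm; rewrite [p]monalgE linear_sum big_seq.
elim/big_rec: _ => // w u wp Pu.
have -> : << p@_w *g w >> = p@_w *: (<< w >> : free_alg k 4).
  by apply/malgP => m; rewrite mcoeffZ !mcoeffU mulr_natr.
by rewrite linearZ /= free_alg_monomE rmorph_prod; apply: PD => //; apply: Pm.
Qed.

Lemma homogA_ind d (P : A -> Prop) :
  P 0 -> (forall c u v, P u -> P v -> P (c *: u + v)) ->
  (forall s : seq 'I_4, size s = d -> P (\prod_(j <- s) x j)) ->
  forall u, homog d u -> P u.
Proof.
move=> P0 PD Pm _ [p hp ->]; apply: toA_span => // w /hp hw.
exact: Pm.
Qed.

Lemma algA_ext (S : algType k) (f g : {lrmorphism A -> S}) :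
  (forall j, f (x j) = g (x j)) -> f =1 g.
Proof.
move=> fg; elim/quot_alg_ind=> p.
apply: (toA_span (P := fun u => f u = g u)) => [|c u v fu fv|w _].
- by rewrite !linear0.
- by rewrite !linearP /= fu fv.
- by rewrite !rmorph_prod /=; apply: eq_bigr.
Qed.

(** The universal property of the presentation: evaluation at [y] kills the
    relators, hence the ideal they generate, and so factors through [A]. *)
Lemma algA_lift (S : algType k) (y : 'I_4 -> S) :
  all (fun r => r == 0) (relators al be ga y) ->
  exists f : {lrmorphism A -> S}, forall j, f (x j) = y j.
Proof.
move=> hy.
have ev_rel : all (fun r => free_eval y r == 0)
    (relators al be ga (@free_gen k 4)).
  rewrite -[all _ _](all_map (free_eval y) (fun r => r == 0)).
  rewrite lrmorph_relators; have -> // : free_eval y \o @free_gen k 4 = y.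
  by apply/funext => j; exact: free_eval_gen.
(* evaluation does not depend on the representative chosen by [repr] *)
have evE p q : toA al be ga p = toA al be ga q -> free_eval y p = free_eval y q.
  move=> /pi_eq pq; apply/eqP; rewrite -subr_eq0 -raddfB; apply/eqP.
  exact: ideal_gen_ker ev_rel pq.
pose f (u : A) : S := free_eval y (repr u).
have fE p : f (toA al be ga p) = free_eval y p by apply: evE; exact: reprK.
have f_lin : linear f.
  move=> c; elim/quot_alg_ind=> p; elim/quot_alg_ind=> q.
  change (f (c *: toA al be ga p + toA al be ga q) =
    c *: f (toA al be ga p) + f (toA al be ga q)).
  by rewrite -linearP !fE linearP.
have f_mon : GRing.monoid_morphism f.
  split; first by rewrite -(rmorph1 (toA al be ga)) fE rmorph1.
  elim/quot_alg_ind=> p; elim/quot_alg_ind=> q.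
  change (f (toA al be ga p * toA al be ga q) =
    f (toA al be ga p) * f (toA al be ga q)).
  by rewrite -rmorphM !fE rmorphM.
pose L := GRing.isLinear.Build _ _ _ _ f f_lin.
pose M := GRing.isMonoidMorphism.Build _ _ f f_mon.
pose F : {lrmorphism A -> S} := HB.pack f L M.
by exists F => j; rewrite -[LHS]/(f _) fE free_eval_gen.
Qed.

End AlgebraA.

(** * The six relations and their symmetries *)

Section Relations.
Variables (k : fieldType) (S : algType k).
Implicit Types (u v x : S).

Definition relations (al be ga : k) x0 x1 x2 x3 : Prop :=
  [/\ commr x0 x1 = al *: acommr x2 x3, commr x0 x2 = be *: acommr x3 x1,
      commr x0 x3 = ga *: acommr x1 x2
    & [/\ acommr x0 x1 = commr x2 x3, acommr x0 x2 = commr x3 x1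
        & acommr x0 x3 = commr x1 x2]].

Lemma relatorsP al be ga (y : 'I_4 -> S) :
  reflect (relations al be ga (y j0) (y j1) (y j2) (y j3))
    (all (fun r => r == 0) (relators al be ga y)).
Proof.
rewrite /relators /all !subr_eq0 andbT.
apply: (iffP idP) => [|[-> -> -> [-> -> ->]]]; last by rewrite !eqxx.
by do 5!case/andP=> /eqP ?; move=> /eqP ?.
Qed.

(** The cyclic symmetry of the presentation, which exchanges the roles of
    [psi_1], [psi_2] and [psi_3]. *)
Lemma relations_rot al be ga x0 x1 x2 x3 :
  relations al be ga x0 x1 x2 x3 -> relations be ga al x0 x2 x3 x1.
Proof. by case=> ? ? ? []. Qed.

Lemma commrC u v : commr u v = - commr v u.
Proof. by rewrite /commr opprB. Qed.

Lemma acommrC u v : acommr u v = acommr v u.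
Proof. by rewrite /acommr addrC. Qed.

Lemma commrZ c d u v : commr (c *: u) (d *: v) = (c * d) *: commr u v.
Proof.
by rewrite /commr -!scalerAl -!scalerAr !scalerA scalerBr (mulrC d).
Qed.

Lemma acommrZ c d u v : acommr (c *: u) (d *: v) = (c * d) *: acommr u v.
Proof.
by rewrite /acommr -!scalerAl -!scalerAr !scalerA scalerDr (mulrC d).
Qed.

Lemma relationsZ al be ga l x0 x1 x2 x3 : relations al be ga x0 x1 x2 x3 ->
  relations al be ga (l *: x0) (l *: x1) (l *: x2) (l *: x3).
Proof.
case=> h1 h2 h3 [h4 h5 h6].
by split; last split; rewrite !(commrZ, acommrZ) ?(h1, h2, h3, h4, h5, h6)
  // !scalerA mulrC.
Qed.

(** The computation behind (1).  Substituting the images of the [x_j] turns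
    the first and fourth relations into multiples of themselves, exchanges the
    second with the fifth, and exchanges the third with the sixth.  The factor
    [l] is free because the relations are homogeneous. *)
Lemma relations_twist i al b c l x0 x1 x2 x3 : i ^+ 2 = -1 ->
  relations al (b ^+ 2) (c ^+ 2) x0 x1 x2 x3 ->
  relations al (b ^+ 2) (c ^+ 2)
    ((l * (b * c)) *: x1) ((l * - i) *: x0)
    ((l * - (i * b)) *: x3) ((l * - c) *: x2).
Proof.
move=> i2 [h1 h2 h3 [h4 h5 h6]].
split; last split; rewrite !(commrZ, acommrZ).
- rewrite (commrC x1) h1 (acommrC x3) scalerN -scaleNr !scalerA.
  by congr (_ *: _); ring.
- rewrite (commrC x1) (acommrC x2) h5 !scalerA scalerN -scaleNr.
  by congr (_ *: _); ring.
- rewrite h6 !scalerA; congr (_ *: _); ring: i2.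
- rewrite acommrC h4 (commrC x3) scalerN -scaleNr; congr (_ *: _); ring.
- rewrite (acommrC x1) (commrC x2) h2 scalerN -scaleNr !scalerA.
  by congr (_ *: _); ring.
- rewrite h3 !scalerA; congr (_ *: _); ring: i2.
Qed.

End Relations.

(** * Extending linear maps of V to graded automorphisms *)

Section GradedAutomorphisms.
Variables (k : fieldType) (al be ga : k).
Local Notation A := (algA al be ga).
Local Notation x := (xA al be ga).
Local Notation homog := (@homogA k al be ga).
Local Notation toV := (VtoA al be ga).
Local Notation Aut := (aut_gr al be ga).

Lemma VtoA_is_linear : linear toV.
Proof.
move=> c u v; rewrite /VtoA scaler_sumr -big_split.
by apply: eq_bigr => j _; rewrite !mxE scalerDl scalerA.
Qed.
HB.instance Definition _ :=
  GRing.isLinear.Build k 'rV[k]_4 A _ toV VtoA_is_linear.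

Lemma aut_fun_linear (f : Aut) : linear f.
Proof. by have [[]] := aut_grP f. Qed.
Lemma aut_fun_monoid_morphism (f : Aut) : GRing.monoid_morphism f.
Proof. by have [[]] := aut_grP f. Qed.
HB.instance Definition _ (f : Aut) :=
  GRing.isLinear.Build k A A _ (aut_fun f) (aut_fun_linear f).
HB.instance Definition _ (f : Aut) :=
  GRing.isMonoidMorphism.Build A A (aut_fun f) (aut_fun_monoid_morphism f).

Lemma aut_gr_ext_gen (f g : Aut) : (forall j, f (x j) = g (x j)) -> f = g.
Proof. by move=> fg; apply/aut_gr_ext/algA_ext. Qed.

Lemma rowV_xV (v : 'rV[k]_4) : v = \sum_j v 0 j *: xV k j.
Proof. exact: row_sum_delta. Qed.

Lemma extendsP (psi : 'End('rV[k]_4)) (f : {linear A -> A}) :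
  (forall j, f (x j) = toV (psi (xV k j))) <-> extends psi f.
Proof.
split=> [fx v|fx j]; last by rewrite -VtoA_xV fx.
rewrite [v in RHS]rowV_xV [toV v]/VtoA !linear_sum.
by apply: eq_bigr => j _; rewrite !linearZ /= fx.
Qed.

Lemma extends_unique (psi : 'End('rV[k]_4)) (f : Aut) :
  extends psi f -> unique (fun f : Aut => extends psi f) f.
Proof.
move=> hf; split=> // g hg; apply: aut_gr_ext_gen => j.
by rewrite -!VtoA_xV hf hg.
Qed.

Lemma graded_endomorphism (psi : 'End('rV[k]_4)) :
  (let y j := toV (psi (xV k j)) in
   relations al be ga (y j0) (y j1) (y j2) (y j3)) ->
  exists F : {lrmorphism A -> A},
    extends psi F /\ forall d u, homog d u -> homog d (F u).
Proof.
move=> /= rel_y; pose y j := toV (psi (xV k j)).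
have [F Fx] := algA_lift (introT (relatorsP al be ga y) rel_y).
exists F; split; first exact/extendsP.
move=> d; apply: homogA_ind => [|c u v hu hv|s <-].
- by rewrite linear0; exact: homogA0.
- by rewrite linearP; apply: homogAD hv; apply: homogAZ.
- rewrite rmorph_prod (eq_bigr y) => [|j _]; last exact: Fx.
  by apply: homogA_prod => j; exact: homogA_V.
Qed.

Lemma aut_of_endomorphisms (F G : {lrmorphism A -> A}) :
  (forall d u, homog d u -> homog d (F u)) ->
  (forall d u, homog d u -> homog d (G u)) ->
  (forall j, G (F (x j)) = x j) -> (forall j, F (G (x j)) = x j) ->
  exists f : Aut, f =1 F.
Proof.
move=> Fgr Ggr GFx FGx.
have GF : cancel F G by exact: (algA_ext (f := G \o F) (g := idfun)).
have FG : cancel G F by exact: (algA_ext (f := F \o G) (g := idfun)).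
have hF : `[< gr_automorphism F >].
  apply/asboolP; split; first split.
  - exact: linearP.
  - by split; [exact: rmorph1 | exact: rmorphM].
  - by exists G.
  - by move=> d u; split=> [/Fgr //|/Ggr]; rewrite GF.
by exists (mk_aut hF).
Qed.

(** A map of order dividing 4 is invertible with inverse its cube, so that no
    separate check of the relations is needed for the inverse. *)
Lemma graded_extension (psi : 'End('rV[k]_4)) :
  (let y j := toV (psi (xV k j)) in
   relations al be ga (y j0) (y j1) (y j2) (y j3)) ->
  (forall j, psi (psi (psi (psi (xV k j)))) = xV k j) ->
  exists f : Aut, extends psi f.
Proof.
move=> rel_y psi4; have [F [Fpsi Fgr]] := graded_endomorphism rel_y.
pose G : {lrmorphism A -> A} := F \o (F \o F).
have F4 j : F (F (F (F (x j)))) = x j by rewrite -VtoA_xV !Fpsi psi4.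
have [|f fF] := @aut_of_endomorphisms F G Fgr _ F4 F4.
  by move=> d u hu; do 3!apply: (Fgr).
by exists f => v; rewrite fF.
Qed.

Lemma algA_relations : relations al be ga (x j0) (x j1) (x j2) (x j3).
Proof.
apply/(relatorsP al be ga x).
rewrite -[relators al be ga x](lrmorph_relators (toA al be ga)) all_map.
apply/allP => r hr; apply/eqP; rewrite -(linear0 (toA al be ga)).
apply/pi_eq; rewrite subr0; apply/asboolP.
by exists [:: (1, r, 1)]; rewrite ?big_seq1 ?mul1r ?mulr1 //= andbT.
Qed.

(** Scaling the generators respects the relations because they are
    homogeneous; on a product of [d] generators the scalars multiply up. *)
Lemma scaling_endomorphism l : exists F : {lrmorphism A -> A},
  forall d u, homog d u -> F u = l ^+ d *: u.
Proof.
have [F Fx] := algA_lift (introT (relatorsP al be ga (fun j => l *: x j))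
  (relationsZ l algA_relations)).
exists F => d; apply: homogA_ind => [|c u v Fu Fv|s <-].
- by rewrite linear0 scaler0.
- by rewrite linearP /= Fu Fv scalerDr !scalerA mulrC.
- elim: s => [|j s IHs]; first by rewrite big_nil rmorph1 scale1r.
  by rewrite big_cons rmorphM /= Fx IHs -scalerAl -scalerAr scalerA exprS.
Qed.

Lemma homogA_gen j : homog 1 (x j).
Proof. by rewrite -VtoA_xV; exact: homogA_V. Qed.

Lemma phi_exists l : l != 0 -> exists f : Aut, is_phi l f.
Proof.
move=> l0; have [F hF] := scaling_endomorphism l.
have [G hG] := scaling_endomorphism l^-1.
have Fgr d u : homog d u -> homog d (F u).
  by move=> hu; rewrite (hF d) //; apply: homogAZ.
have Ggr d u : homog d u -> homog d (G u).
  by move=> hu; rewrite (hG d) //; apply: homogAZ.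
have [||f fF] := aut_of_endomorphisms Fgr Ggr.
- move=> j; have hj := homogA_gen j.
  by rewrite (hG 1%N) ?(hF 1%N) ?scalerA ?mulVf ?scale1r //; apply: homogAZ.
- move=> j; have hj := homogA_gen j.
  by rewrite (hF 1%N) ?(hG 1%N) ?scalerA ?mulfV ?scale1r //; apply: homogAZ.
- by exists f => d u /hF; rewrite fF.
Qed.

Lemma phi_gen l (f : Aut) j : is_phi l f -> f (x j) = l *: x j.
Proof. by move=> /(_ 1%N _ (homogA_gen j)). Qed.

(** Sending every [x_j] to one nonzero matrix of square zero satisfies any
    homogeneous quadratic relations. *)
Lemma xA_neq0 j : x j != 0.
Proof.
pose e : 'M[k]_2 := delta_mx 0 1.
have ee : e * e = 0 by rewrite -[_ * _]/(_ *m _) mul_delta_mx_cond.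
have [|f fx] := @algA_lift _ al be ga 'M[k]_2 (fun=> e).
  by apply/relatorsP; rewrite /relations /commr /acommr ee subrr addr0 !scaler0.
apply/eqP => xj0; have /matrixP/(_ 0 1) := fx j.
by rewrite xj0 linear0 !mxE /= => /eqP; rewrite eq_sym oner_eq0.
Qed.

End GradedAutomorphisms.

(** * Groups given by generators and relations *)

Section PresentedGroups.
Variables (n : nat) (rels : seq (word n * word n)).
Variables (G : groupType) (h : 'I_n -> G).
Local Open Scope group_scope.

Definition letter_eval (l : bool * 'I_n) : G := if l.1 then (h l.2)^-1 else h l.2.
Definition word_eval (w : word n) : G := \prod_(l <- w) letter_eval l.

Lemma word_eval_cat u v : word_eval (u ++ v) = word_eval u * word_eval v.
Proof. exact: big_cat. Qed.

Lemma word_eval_gen g : word_eval (word_gen g) = h g.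
Proof. exact: big_seq1. Qed.

Lemma word_eval_exp u m : word_eval (word_exp u m) = word_eval u ^+ m.
Proof.
elim: m => [|m IHm]; first exact: big_nil.
by rewrite /word_exp /= word_eval_cat IHm expgS.
Qed.

Lemma pres_lift :
  (forall u v, (u, v) \in rels -> word_eval u = word_eval v) ->
  exists Phi : UMagmaMorphism.type (pres_group rels) G,
    forall g, Phi (pres_gen rels g) = h g.
Proof.
move=> hrel.
have ev_cong u v : word_cong rels u v -> word_eval u = word_eval v.
  elim=> {u v} [|e g|u u' v v' _ Hu _ Hv||u v _ ->|u v w _ -> _ ->] //.
  - rewrite /word_eval big_cons big_seq1 big_nil /letter_eval /=.
    by case: e => /=; rewrite (mulVg, mulgV).
  - by rewrite !word_eval_cat Hu Hv.
pose Phi (y : pres_group rels) : G := word_eval (repr y).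
have PhiE w : Phi (pres_pi rels w) = word_eval w by apply/ev_cong/repr_pres.
have Phi_mon : monoid.monoid_morphism Phi.
  split=> [|y z]; first by rewrite PhiE /word_eval big_nil.
  by rewrite PhiE word_eval_cat.
pose M := monoid.isUMagmaMorphism.Build _ _ Phi Phi_mon.
pose F : UMagmaMorphism.type (pres_group rels) G := HB.pack Phi M.
by exists F => g; rewrite -[LHS]/(Phi _) PhiE word_eval_gen.
Qed.

End PresentedGroups.

Section PresentedGroupWords.
Variables (n : nat) (rels : seq (word n * word n)).
Local Open Scope group_scope.

Lemma pres_pi_eval w : pres_pi rels w = word_eval (pres_gen rels) w.
Proof.
elim: w => [|l w IHw]; first by rewrite /word_eval big_nil.
rewrite /word_eval big_cons -[X in _ * X]/(word_eval _ w) -IHw.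
rewrite -cat1s pres_piM; congr (_ * _).
by case: l => -[] g //; exact: (@pres_piV n rels (word_gen g)).
Qed.

Lemma pres_group_rel u v : (u, v) \in rels ->
  word_eval (pres_gen rels) u = word_eval (pres_gen rels) v.
Proof. by move=> uv; rewrite -!pres_pi_eval; apply/pres_pi_eq/wc_rel. Qed.

(** Inverses of generators are listed separately because a presented group
    need not be generated as a monoid by its generators. *)
Lemma pres_group_gen_ind (P : pres_group rels -> Prop) :
  P 1 -> (forall g y, P y -> P (pres_gen rels g * y)) ->
  (forall g y, P y -> P ((pres_gen rels g)^-1 * y)) -> forall y, P y.
Proof.
move=> P1 Pg PV; elim/pres_group_ind=> w; rewrite pres_pi_eval /word_eval.
by elim/big_rec: _ => // -[[] g] y _ Py; [exact: PV | exact: Pg].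
Qed.

End PresentedGroupWords.

(** * The Heisenberg group of order 64 *)

Section HeisenbergGroup.
Local Open Scope group_scope.

Section HeisenbergCommutation.
Variables (G : groupType) (e1 e2 d : G).
Hypotheses (d1 : commute d e1) (d2 : commute d e2) (e12 : e1 * e2 = d * e2 * e1).

Lemma heisenberg_expl p : e1 ^+ p * e2 = d ^+ p * e2 * e1 ^+ p.
Proof.
elim: p => [|p IHp]; first by rewrite !expg0 mul1g mulg1.
rewrite expgS -mulgA IHp !mulgA (commuteX p (commute_sym d1)) -(mulgA _ e1) e12.
by rewrite !mulgA -expgSr.
Qed.

Lemma heisenberg_expr q : e1 * e2 ^+ q = d ^+ q * e2 ^+ q * e1.
Proof.
elim: q => [|q IHq]; first by rewrite !expg0 !mulg1 mul1g.
rewrite [e2 ^+ _]expgSr mulgA IHq -mulgA e12 !mulgA.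
rewrite -(mulgA _ _ d) -(commuteX q d2) !mulgA -expgSr.
by rewrite -(mulgA _ (e2 ^+ q)) -expgSr.
Qed.

End HeisenbergCommutation.

Local Notation e1 := H4_eps1.
Local Notation e2 := H4_eps2.
Local Notation d := H4_delta.

Lemma H4_relations :
  [/\ e1 ^+ 4 = 1, e2 ^+ 4 = 1, d ^+ 4 = 1
    & [/\ commute d e1, commute d e2 & e1 * e2 = d * e2 * e1]].
Proof.
have h i (hi : (i < 6)%N) :
    let r := nth ([::], [::]) H4_rels i in
    word_eval (pres_gen H4_rels) r.1 = word_eval (pres_gen H4_rels) r.2.
  by apply: pres_group_rel; rewrite -surjective_pairing; exact: mem_nth.
move: (h 0%N isT) (h 1%N isT) (h 2 isT) (h 3 isT) (h 4 isT) (h 5 isT) => /=.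
rewrite /word_eval !big_cons !big_nil /letter_eval /= !mulg1.
move=> h1 h2 h3 h4 h5 h6; rewrite !expgS !expg0 !mulg1 -mulgA.
by split=> //; split.
Qed.

(** The set of elements of this form contains 1 and is stable under left
    multiplication by the generators: moving [e2] past [e1 ^+ p] costs
    [d ^- p], which is [d ^+ (p * 3)] and is central.  Inverses of generators
    are their cubes. *)
Lemma H4_normal_form (y : H4) :
  exists p q r, y = e1 ^+ p * e2 ^+ q * d ^+ r.
Proof.
have [e14 e24 d4 [de1 de2 e12]] := H4_relations.
have ord3 (g : 'I_3) : [\/ g = 0%R, g = 1%R | g = 2%R].
  by case: g => -[|[|[|//]]] hg;
    [constructor 1 | constructor 2 | constructor 3]; exact: val_inj.
pose NF y := exists p q r, y = e1 ^+ p * e2 ^+ q * d ^+ r :> H4.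
have NF1 z : NF z -> NF (e1 * z).
  by move=> [p [q [r ->]]]; exists p.+1, q, r; rewrite expgS !mulgA.
have NFd z : NF z -> NF (d * z).
  move=> [p [q [r ->]]]; exists p, q, r.+1; rewrite expgSr !mulgA.
  have /commute_sym <- : commute (e1 ^+ p * e2 ^+ q * d ^+ r) d.
    apply/commute_sym/commuteM/commuteX/commute_refl.
    by apply: commuteM; apply: commuteX.
  by rewrite !mulgA.
have NFX n z : NF z -> NF (d ^+ n * z).
  by elim: n => [|n IHn] hz; rewrite ?mul1g // expgS -mulgA; apply/NFd/IHn.
have NF2 z : NF z -> NF (e2 * z).
  move=> [p [q [r ->]]].
  have -> : e2 * (e1 ^+ p * e2 ^+ q * d ^+ r) =
            d ^+ (p * 3) * (e1 ^+ p * e2 ^+ q.+1 * d ^+ r).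
    rewrite [e2 ^+ _.+1]expgS !mulgA; congr (_ * _ * _).
    rewrite -[RHS]mulgA (heisenberg_expl de1 e12) !mulgA -expgnDr.
    by rewrite -mulnSr mulnC expgnA d4 expg1n mul1g.
  by apply: NFX; exists p, q.+1, r.
have NF_gen g z : NF z -> NF (pres_gen H4_rels g * z).
  case: (ord3 g) => ->; [exact: NF1 | exact: NF2 | exact: NFd].
have gen4 g : pres_gen H4_rels g ^+ 4 = 1 by case: (ord3 g) => ->.
elim/(pres_group_gen_ind (rels := H4_rels)): y => [|g z hz|g z hz].
- by exists 0%N, 0%N, 0%N; rewrite !mulg1.
- exact: NF_gen.
- have -> : (pres_gen H4_rels g)^-1 = pres_gen H4_rels g ^+ 3.
    by apply: mulg1_eq; rewrite -expgS.
  by rewrite -iter_mulg /=; do 3!apply: (NF_gen).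
Qed.

Lemma expg4_dvd (G : groupType) (z : G) n :
  z ^+ 4 = 1 -> z ^+ 2 != 1 -> z ^+ n = 1 -> (4 %| n)%N.
Proof.
move=> z4 z2; rewrite {1}(divn_eq n 4) expgnDr mulnC expgnA z4 expg1n mul1g.
rewrite /dvdn; have := ltn_pmod n (isT : 0 < 4)%N.
case: (n %% 4)%N => [|[|[|[|//]]]] // _ zm.
- by move: z2; rewrite expg2 -[z]expg1 zm mulg1 eqxx.
- by rewrite zm eqxx in z2.
- by move: z4 z2; rewrite expgSr zm mul1g expg2 => ->; rewrite mulg1 eqxx.
Qed.

(** A nontrivial normal subgroup of [H_4] meets the centre nontrivially: the
    commutators of [e1 ^+ p * e2 ^+ q * d ^+ r] with [e2] and [e1] are powers
    of [d], with exponents [p] and [q] up to sign.  Hence only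
    the order of the image of [d] has to be controlled. *)
Lemma H4_injective (G : groupType) (Phi : UMagmaMorphism.type H4 G) :
  Phi d ^+ 2 != 1 -> injective Phi.
Proof.
have [e14 e24 d4 [de1 de2 e12]] := H4_relations.
move=> d2; have Phi_d4 n : Phi (d ^+ n) = 1 -> (4 %| n)%N.
  move=> dn; apply: expg4_dvd d2 _; last by rewrite -gmulfXn.
  by rewrite -gmulfXn d4 gmulf1.
have pow4 (z : H4) n : z ^+ 4 = 1 -> (4 %| n)%N -> z ^+ n = 1.
  by move=> z4 /dvdnP[m ->]; rewrite mulnC expgnA z4 expg1n.
apply: gmulf_inj => y; have [p [q [r yE]]] := H4_normal_form y.
move=> Phiy.
have comm_e2 : y * e2 = d ^+ p * e2 * y.
  rewrite yE -!mulgA -(commuteX r (commute_sym de2)) !mulgA -(mulgA _ _ e2).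
  by rewrite -expgSr expgS !mulgA (heisenberg_expl de1 e12).
have comm_e1 : e1 * y = d ^+ q * y * e1.
  rewrite yE !mulgA -expgS expgSr -(mulgA _ e1) (heisenberg_expr de2 e12) !mulgA.
  rewrite -(mulgA _ e1 (d ^+ r)) (commuteX r (commute_sym de1)) !mulgA.
  by congr (_ * _ * _ * _); apply: commuteX2 (commute_sym de1).
have p4 : (4 %| p)%N.
  apply: Phi_d4; apply: (mulIg (Phi e2)); rewrite mul1g.
  by have := congr1 Phi comm_e2; rewrite !gmulfM Phiy mul1g mulg1.
have q4 : (4 %| q)%N.
  apply: Phi_d4; apply: (mulIg (Phi e1)); rewrite mul1g.
  by have := congr1 Phi comm_e1; rewrite !gmulfM Phiy mulg1 mulg1.
have yd : y = d ^+ r by rewrite yE (pow4 _ p) // (pow4 _ q) // !mul1g.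
have r4 : (4 %| r)%N by apply: Phi_d4; rewrite -yd.
by rewrite yd (pow4 _ r).
Qed.

End HeisenbergGroup.

(** * Klein groups *)

Section KleinGroup.
Variables (G : groupType) (g1 g2 : G).
Local Open Scope group_scope.
Hypotheses (g1K : g1 ^+ 2 = 1) (g2K : g2 ^+ 2 = 1) (g12 : commute g1 g2).
Hypotheses (g1_neq1 : g1 != 1) (g2_neq1 : g2 != 1) (g1_neq_g2 : g1 != g2).

Lemma expg_Z2D (z : G) (s t : 'Z_2) :
  z ^+ 2 = 1 -> z ^+ (s + t)%R = z ^+ s * z ^+ t.
Proof.
move=> z2; rewrite -expgnDr [in RHS](divn_eq (s + t) 2) expgnDr mulnC expgnA.
by rewrite z2 expg1n mul1g.
Qed.

Lemma klein_subgroup :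
  exists theta : 'Z_2 * 'Z_2 -> G,
    [/\ injective theta, {morph theta : s t / (s + t)%R >-> s * t}
      & forall g, in_generated [:: g1; g2; g1 * g2] g <-> exists s, theta s = g].
Proof.
pose theta (s : 'Z_2 * 'Z_2) := g1 ^+ s.1 * g2 ^+ s.2.
have thetaD : {morph theta : s t / (s + t)%R >-> s * t}.
  move=> [s1 s2] [t1 t2]; rewrite /theta /= !expg_Z2D // !mulgA.
  congr (_ * _); rewrite -!mulgA; congr (_ * _).
  exact: commuteX2.
have theta0 : theta 0%R = 1 by rewrite /theta /= mulg1.
have g12_neq1 : g1 * g2 != 1.
  apply: contra g1_neq_g2 => /eqP g12_1; apply/eqP.
  by apply: (mulIg g2); rewrite g12_1 -expg2 g2K.
have theta_ker s : theta s = 1 -> s = 0%R.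
  case: s => -[[|[|//]] hs] [[|[|//]] ht]; rewrite /theta /=.
  - by move=> _; congr pair; apply: val_inj.
  - by rewrite mul1g => /eqP; rewrite (negPf g2_neq1).
  - by rewrite mulg1 => /eqP; rewrite (negPf g1_neq1).
  - by move/eqP; rewrite (negPf g12_neq1).
exists theta; split=> // [s t st|g].
  apply/eqP; rewrite -GRing.subr_eq0; apply/eqP/theta_ker/(mulIg (theta t)).
  by rewrite -thetaD GRing.subrK mul1g.
split=> [gen_g|[s <-] H sub_H].
  pose Hp : {pred G} := fun z => `[< exists s, theta s = z >].
  have HpV : invg_closed Hp.
    move=> _ /asboolP[s <-]; apply/asboolP; exists (- s)%R.
    by apply/esym/mulg1_eq; rewrite -thetaD GRing.subrr.
  have Hp1 : 1 \in Hp by apply/asboolP; exists 0%R.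
  have HpM : mulg_closed Hp.
    move=> _ _ /asboolP[s <-] /asboolP[t <-]; apply/asboolP.
    by exists (s + t)%R; rewrite thetaD.
  pose H : groupClosed G := HB.pack Hp (monoid.isInvClosed.Build G Hp HpV)
    (monoid.isMul1Closed.Build G Hp Hp1) (monoid.isMulClosed.Build G Hp HpM).
  apply/asboolP/(gen_g H) => z; rewrite !inE => /or3P[]/eqP->; apply/asboolP.
  - by exists (1, 0)%R; rewrite /theta /= mulg1.
  - by exists (0, 1)%R; rewrite /theta /= mul1g.
  - by exists (1, 1)%R.
by apply: gpredM; apply: gpredXn; apply: sub_H; rewrite !inE eqxx ?orbT.
Qed.

End KleinGroup.

(** * The common shape of the three linear maps *)

Section Twists.
Variables (k : fieldType) (i : k).
Hypothesis i2 : i ^+ 2 = -1.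
Local Notation End4 := 'End('rV[k]_4).
Local Notation xV := (xV k).

(** [psi_1] scaled by [l], up to a relabelling of [1, 2, 3] as [p, q, r];
    the cyclic relabellings give [psi_2] and [psi_3]. *)
Definition twist (l b c : k) (p q r : 'I_4) (psi : End4) : Prop :=
  [/\ psi (xV j0) = (l * (b * c)) *: xV p, psi (xV p) = (l * - i) *: xV j0,
      psi (xV q) = (l * - (i * b)) *: xV r & psi (xV r) = (l * - c) *: xV q].

Lemma psi1_twist l b c : twist l b c j1 j2 j3 (l *: psi1 i b c).
Proof. by split; rewrite scale_lfunE linext_xV scalerA. Qed.

Lemma psi2_twist l a c : twist l c a j2 j3 j1 (l *: psi2 i a c).
Proof. by split; rewrite scale_lfunE linext_xV scalerA // (mulrC a). Qed.

Lemma psi3_twist l a b : twist l a b j3 j1 j2 (l *: psi3 i a b).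
Proof. by split; rewrite scale_lfunE linext_xV scalerA. Qed.

Lemma twist_square l b c p q r psi :
  twist l b c p q r psi -> l ^+ 2 * (i * b * c) = -1 ->
  [/\ psi (psi (xV j0)) = xV j0, psi (psi (xV p)) = xV p,
      psi (psi (xV q)) = - xV q & psi (psi (xV r)) = - xV r].
Proof.
move=> [h0 hp hq hr] hl.
split; rewrite ?h0 ?hp ?hq ?hr linearZ /= ?h0 ?hp ?hq ?hr scalerA.
- by rewrite -[RHS]scale1r; congr (_ *: _); ring: hl.
- by rewrite -[RHS]scale1r; congr (_ *: _); ring: hl.
- by rewrite -scaleN1r; congr (_ *: _); ring: hl.
- by rewrite -scaleN1r; congr (_ *: _); ring: hl.
Qed.

Lemma twist_VtoA_relations al be ga al' l b c p q r psi :
  let toV := VtoA al be ga in let x := xA al be ga in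
  twist l b c p q r psi ->
  relations al' (b ^+ 2) (c ^+ 2) (x j0) (x p) (x q) (x r) ->
  relations al' (b ^+ 2) (c ^+ 2) (toV (psi (xV j0))) (toV (psi (xV p)))
    (toV (psi (xV q))) (toV (psi (xV r))).
Proof.
move=> toV x [-> -> -> ->]; rewrite /toV !linearZ /= !VtoA_xV.
exact: relations_twist.
Qed.

Lemma ord4P (P : 'I_4 -> Prop) : P j0 -> P j1 -> P j2 -> P j3 -> forall j, P j.
Proof.
move=> P0 P1 P2 P3 [[|[|[|[|//]]]] hj]; rewrite (bool_irrelevance hj isT) //.
Qed.

(** The source of the relation [e1 e2 = d e2 e1]. *)
Lemma psi12_commutation l m a b c :
  let f := (l *: psi1 i b c)%R in let g := (m *: psi2 i a c)%R in
  forall j, f (g (xV j)) = i *: g (f (xV j)).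
Proof.
move=> f g; have [f0 f1 f2 f3] := psi1_twist l b c.
have [g0 g2 g3 g1] := psi2_twist m a c.
apply: ord4P; rewrite ?(f0, f1, f2, f3, g0, g1, g2, g3) !linearZ /=
  ?(f0, f1, f2, f3, g0, g1, g2, g3) !scalerA; congr (_ *: _); ring: i2.
Qed.

End Twists.

(** * The normalised automorphisms *)

Section TwistAutomorphisms.
Variables (k : fieldType) (i al be ga : k).
Hypothesis i2 : i ^+ 2 = -1.
Local Notation Aut := (aut_gr al be ga).
Local Notation x := (xA al be ga).
Local Notation toV := (VtoA al be ga).

(** The hypothesis on [l] is the condition on [nu_j] for [l = nu_j^-1]; it
    makes the square of [psi] a diagonal matrix of signs, so that [psi] has
    order dividing 4. *)
Lemma twist_automorphism l b c p q r (psi : 'End('rV[k]_4)) :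
  (forall P : 'I_4 -> Prop, P j0 -> P p -> P q -> P r -> forall j, P j) ->
  twist i l b c p q r psi -> l ^+ 2 * (i * b * c) = -1 ->
  (let y j := toV (psi (xV k j)) in
   relations al be ga (y j0) (y j1) (y j2) (y j3)) ->
  exists2 f : Aut, extends psi f &
    [/\ f (f (x j0)) = x j0, f (f (x p)) = x p,
        f (f (x q)) = - x q & f (f (x r)) = - x r].
Proof.
move=> indexP tw hl rel_y; have [h0 hp hq hr] := twist_square tw hl.
have [|f hf] := graded_extension rel_y.
  by apply: indexP; rewrite ?h0 ?hp // ?hq ?hr !linearN /= ?hq ?hr opprK.
have fE j : f (f (x j)) = toV (psi (psi (xV k j))) by rewrite -VtoA_xV !hf.
exists f; first exact: hf.
by split; rewrite fE ?h0 ?hp ?hq ?hr ?linearN /= VtoA_xV.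
Qed.

(** Compose with [phi_nu], which is multiplication by [nu] on [V]. *)
Lemma unscale_extension nu (psi : 'End('rV[k]_4)) (f : Aut) : nu != 0 ->
  extends (nu^-1 *: psi)%R f ->
  exists2 g : algA al be ga -> algA al be ga, alg_automorphism g & extends psi g.
Proof.
move=> nu0 hf; have [h hh] := phi_exists al be ga nu0.
exists (aut_fun (h * f)%g); first by have [] := aut_grP (h * f)%g.
move=> v; rewrite aut_grM hf (hh 1%N) ?scale_lfunE; last exact: homogA_V.
by rewrite linearZ /= scalerA mulfV // scale1r.
Qed.

Lemma xA_neqN j : (2%:R : k) != 0 -> x j <> - x j.
Proof.
move=> k2 /eqP; rewrite -subr_eq0 opprK -mulr2n -scaler_nat scaler_eq0.
by rewrite (negPf k2) (negPf (xA_neq0 _ _ _ j)).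
Qed.

Lemma phi_order4 (h : Aut) : is_phi i h -> (h ^+ 4)%g = 1%g.
Proof.
move=> hh; apply: aut_gr_ext_gen => j.
have hZ c : h (c *: x j) = (c * i) *: x j.
  by rewrite linearZ /= (phi_gen j hh) scalerA.
rewrite -[LHS]/(h (h (h (h (x j))))) (phi_gen j hh) !hZ.
have -> : i * i * i * i = 1 by rewrite -mulrA -!expr2 i2 sqrrN expr1n.
by rewrite scale1r.
Qed.

Lemma phi_sqr_neq1 (h : Aut) : (2%:R : k) != 0 -> is_phi i h -> (h ^+ 2)%g <> 1%g.
Proof.
move=> k2 hh /(congr1 (fun g : Aut => g (x j0))).
have hZ c : h (c *: x j0) = (c * i) *: x j0.
  by rewrite linearZ /= (phi_gen j0 hh) scalerA.
rewrite -[LHS]/(h (h (x j0))) (phi_gen j0 hh) hZ -expr2 i2 scaleN1r.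
by rewrite -[RHS]/(x j0); apply/nesym/xA_neqN.
Qed.

(** A graded automorphism is linear and preserves each [A_d], on which
    [phi_l] is a scalar. *)
Lemma phi_central l (h f : Aut) : is_phi l h -> commute h f.
Proof.
move=> hh; apply: aut_gr_ext_gen => j; rewrite !aut_grM (phi_gen _ hh) linearZ.
apply: (hh 1%N); have [_ fgr] := aut_grP f.
exact: (fgr 1%N _).1 (homogA_gen _ _ _ j).
Qed.

Lemma extends_gen (psi : 'End('rV[k]_4)) (f : Aut) j :
  extends psi f -> f (x j) = toV (psi (xV k j)).
Proof. by move=> hf; rewrite -VtoA_xV hf. Qed.

Lemma extends_commutation l (psi psi' : 'End('rV[k]_4)) (f g h : Aut) :
  extends psi f -> extends psi' g -> is_phi l h ->
  (forall j, psi (psi' (xV k j)) = l *: psi' (psi (xV k j))) ->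
  (f * g)%g = (h * g * f)%g.
Proof.
move=> hf hg hh hpsi; apply: aut_gr_ext_gen => j.
have fgx : f (g (x j)) = toV (psi (psi' (xV k j))).
  exact: etrans (congr1 f (extends_gen j hg)) (hf _).
have gfx : g (f (x j)) = toV (psi' (psi (xV k j))).
  exact: etrans (congr1 g (extends_gen j hf)) (hg _).
rewrite aut_grM fgx hpsi linearZ /= -gfx; apply/esym/(hh 1%N).
rewrite gfx; exact: homogA_V.
Qed.

Lemma aut_gr1 u : (1%g : Aut) u = u.
Proof. by []. Qed.

Lemma aut_grN (f : Aut) u : f (- u) = - f u.
Proof. exact: linearN. Qed.

Lemma sign_automorphisms (g1 g2 g3 : Aut) :
  (2%:R : k) != 0 ->
  [/\ g1 (x j0) = x j0, g1 (x j1) = x j1, g1 (x j2) = - x j2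
    & g1 (x j3) = - x j3] ->
  [/\ g2 (x j0) = x j0, g2 (x j1) = - x j1, g2 (x j2) = x j2
    & g2 (x j3) = - x j3] ->
  [/\ g3 (x j0) = x j0, g3 (x j1) = - x j1, g3 (x j2) = - x j2
    & g3 (x j3) = x j3] ->
  [/\ (g1 ^+ 2 = 1)%g, (g2 ^+ 2 = 1)%g, commute g1 g2 & g3 = (g1 * g2)%g] /\
  [/\ g1 != 1%g, g2 != 1%g & g1 != g2].
Proof.
move=> k2 [p0 p1 p2 p3] [q0 q1 q2 q3] [r0 r1 r2 r3].
have xN j : x j <> - x j by exact: xA_neqN.
pose E := (aut_gr1, aut_grM, p0, p1, p2, p3, q0, q1, q2, q3, r0, r1, r2, r3,
  aut_grN, opprK).
split; split.
- apply: aut_gr_ext_gen; apply: ord4P; rewrite expg2 !E; reflexivity.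
- apply: aut_gr_ext_gen; apply: ord4P; rewrite expg2 !E; reflexivity.
- apply: aut_gr_ext_gen; apply: ord4P; rewrite !E; reflexivity.
- apply: aut_gr_ext_gen; apply: ord4P; rewrite !E; reflexivity.
- by apply/eqP => /(congr1 (fun g : Aut => g (x j2))); rewrite !E => /esym/xN.
- by apply/eqP => /(congr1 (fun g : Aut => g (x j1))); rewrite !E => /esym/xN.
- by apply/eqP => /(congr1 (fun g : Aut => g (x j1))); rewrite !E => /xN.
Qed.

End TwistAutomorphisms.

(** Cancels the common factor in the conditions defining the [nu_j]. *)
Lemma inv_sqr_mul (k : fieldType) (a nu z : k) :
  a != 0 -> nu != 0 -> a * nu ^+ 2 = - (a * z) -> nu^-1 ^+ 2 * z = -1.
Proof.
move=> a0 nu0; rewrite -mulrN => /(mulfI a0) nu2.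
by apply: oppr_inj; rewrite -mulrN -nu2 opprK exprVn mulVf // expf_eq0.
Qed.

Theorem proposition2p1 (k : fieldType) (i alpha beta gamma a b c : k)
    (nu1 nu2 nu3 : k)
    (char_k : 2%N \notin [pchar k]) (i2 : i ^+ 2 = -1)
    (a2 : a ^+ 2 = alpha) (b2 : b ^+ 2 = beta) (c2 : c ^+ 2 = gamma)
    (abg_neq0 : alpha * beta * gamma != 0)
    (nu1_neq0 : nu1 != 0) (nu2_neq0 : nu2 != 0) (nu3_neq0 : nu3 != 0)
    (nu1P : a * nu1 ^+ 2 = - (i * a * b * c))
    (nu2P : b * nu2 ^+ 2 = - (i * a * b * c))
    (nu3P : c * nu3 ^+ 2 = - (i * a * b * c)) :
  let A := algA alpha beta gamma in
  let x : 'I_4 -> A := xA alpha beta gamma in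
  (* (1) *)
  [/\ exists2 f : A -> A, alg_automorphism f & extends (psi1 i b c) f,
      exists2 f : A -> A, alg_automorphism f & extends (psi2 i a c) f
    & exists2 f : A -> A, alg_automorphism f & extends (psi3 i a b) f] /\
  (* f1, f2, f3 are the (unique) automorphisms extending nu_j^-1 psi_j *)
  exists f1 f2 f3 : aut_gr alpha beta gamma,
    [/\ unique (fun f : aut_gr alpha beta gamma =>
          extends (nu1^-1 *: psi1 i b c)%R f) f1,
        unique (fun f : aut_gr alpha beta gamma =>
          extends (nu2^-1 *: psi2 i a c)%R f) f2
      & unique (fun f : aut_gr alpha beta gamma =>
          extends (nu3^-1 *: psi3 i a b)%R f) f3] /\
    (* (2) *)
    (exists Phi : {multiplicative H4 -> aut_gr alpha beta gamma},
      [/\ injective Phi, Phi H4_eps1 = f1, Phi H4_eps2 = f2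
        & is_phi i (Phi H4_delta)]) /\
    (* (3) *)
    let g1 : aut_gr alpha beta gamma := (f1 ^+ 2)%g in
    let g2 : aut_gr alpha beta gamma := (f2 ^+ 2)%g in
    let g3 : aut_gr alpha beta gamma := (f3 ^+ 2)%g in
    [/\ exists theta : 'Z_2 * 'Z_2 -> aut_gr alpha beta gamma,
          [/\ injective theta,
              {morph theta : s t / s + t >-> (s * t)%g}
            & forall g : aut_gr alpha beta gamma,
                in_generated [:: g1; g2; g3] g <-> exists s, theta s = g],
        [/\ g1 (x j0) = x j0, g1 (x j1) = x j1, g1 (x j2) = - x j2
          & g1 (x j3) = - x j3],
        [/\ g2 (x j0) = x j0, g2 (x j1) = - x j1, g2 (x j2) = x j2
          & g2 (x j3) = - x j3]
      & [/\ g3 (x j0) = x j0, g3 (x j1) = - x j1, g3 (x j2) = - x j2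
          & g3 (x j3) = x j3]].
Proof.
move=> A x; subst alpha beta gamma.
have [a0 b0 c0] : [/\ a != 0, b != 0 & c != 0].
  move: abg_neq0; rewrite -!exprMn expf_eq0 /= !mulf_eq0 !negb_or.
  by case/andP=> /andP[].
have k2 : 2%:R != 0 :> k by move: char_k; rewrite inE.
have rel0 := algA_relations (a ^+ 2) (b ^+ 2) (c ^+ 2).
have n1 : nu1^-1 ^+ 2 * (i * b * c) = -1.
  by apply: (inv_sqr_mul a0 nu1_neq0); rewrite nu1P; ring.
have n2 : nu2^-1 ^+ 2 * (i * c * a) = -1.
  by apply: (inv_sqr_mul b0 nu2_neq0); rewrite nu2P; ring.
have n3 : nu3^-1 ^+ 2 * (i * a * b) = -1.
  by apply: (inv_sqr_mul c0 nu3_neq0); rewrite nu3P; ring.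
have t1 := psi1_twist i nu1^-1 b c.
have t2 := psi2_twist i nu2^-1 a c.
have t3 := psi3_twist i nu3^-1 a b.
(* Indices are rotated so that 2 (resp. 3) plays the role of 1, [twist] is
   applied, and the rotation is completed to a full turn. *)
have rot2 := relations_rot (relations_rot rel0).
have [|f1 hf1 [f10 f11 f12 f13]] :=
  twist_automorphism _ t1 n1 (twist_VtoA_relations i2 t1 rel0).
  by move=> P P0 P1 P2 P3; apply: ord4P.
have [|f2 hf2 [f20 f22 f23 f21]] := twist_automorphism _ t2 n2 (relations_rot
  (relations_rot (twist_VtoA_relations i2 t2 (relations_rot rel0)))).
  by move=> P P0 P1 P2 P3; apply: ord4P.
have [|f3 hf3 [f30 f33 f31 f32]] := twist_automorphism _ t3 n3 (relations_rot
  (twist_VtoA_relations i2 t3 rot2)).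
  by move=> P P0 P1 P2 P3; apply: ord4P.
split.
  split; [exact: unscale_extension hf1 | exact: unscale_extension hf2 |
    exact: unscale_extension hf3].
exists f1, f2, f3; split.
  split; [exact: (extends_unique hf1) | exact: (extends_unique hf2) |
    exact: (extends_unique hf3)].
pose g1 : aut_gr (a ^+ 2) (b ^+ 2) (c ^+ 2) := (f1 ^+ 2)%g.
have G1 : [/\ g1 (x j0) = x j0, g1 (x j1) = x j1,
  g1 (x j2) = - x j2 & g1 (x j3) = - x j3] := And4 f10 f11 f12 f13.
pose g2 : aut_gr (a ^+ 2) (b ^+ 2) (c ^+ 2) := (f2 ^+ 2)%g.
have G2 : [/\ g2 (x j0) = x j0, g2 (x j1) = - x j1,
  g2 (x j2) = x j2 & g2 (x j3) = - x j3] := And4 f20 f21 f22 f23.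
pose g3 : aut_gr (a ^+ 2) (b ^+ 2) (c ^+ 2) := (f3 ^+ 2)%g.
have G3 : [/\ g3 (x j0) = x j0, g3 (x j1) = - x j1,
  g3 (x j2) = - x j2 & g3 (x j3) = x j3] := And4 f30 f31 f32 f33.
have [[g1K g2K g12 g3E] [g1n1 g2n1 g1n2]] := sign_automorphisms k2 G1 G2 G3.
split; last first.
  split; [|exact: G1 | exact: G2 | exact: G3].
  rewrite -/g3 g3E; exact: klein_subgroup.
have i_neq0 : i != 0 by rewrite -sqrf_eq0 i2 oppr_eq0 oner_eq0.
have [h hh] := phi_exists (a ^+ 2) (b ^+ 2) (c ^+ 2) i_neq0.
have f12h := extends_commutation hf1 hf2 hh (psi12_commutation i2 _ _ a b c).
pose gen (g : 'I_3) := nth f1 [:: f1; f2; h] g.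
have [|Phi Phi_gen] := @pres_lift _ H4_rels _ gen.
  have h4 := phi_order4 i2 hh.
  have f4 (f : aut_gr (a ^+ 2) (b ^+ 2) (c ^+ 2)) :
      (f ^+ 2 ^+ 2 = 1)%g -> (f ^+ 4 = 1)%g by rewrite -expgnA.
  move=> u v; rewrite !inE => /or4P[|||/or3P[]] /eqP[-> ->].
  - by rewrite word_eval_exp word_eval_gen f4 ?/word_eval ?big_nil.
  - by rewrite word_eval_exp word_eval_gen f4 ?/word_eval ?big_nil.
  - by rewrite word_eval_exp word_eval_gen /word_eval big_nil.
  - rewrite /word_eval /= !big_cons !big_nil /letter_eval /= !mulg1.
    exact: phi_central hh.
  - rewrite /word_eval /= !big_cons !big_nil /letter_eval /= !mulg1.
    apply/esym; exact: phi_central hh.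
  - rewrite /word_eval /= !big_cons !big_nil /letter_eval /= !mulg1 mulgA.
    exact: f12h.
have Phi_delta : Phi H4_delta = h by exact: Phi_gen.
exists Phi; split; [|exact: Phi_gen | exact: Phi_gen | by rewrite Phi_delta].
apply: H4_injective; rewrite Phi_delta; apply/eqP.
exact: (phi_sqr_neq1 i2 k2 hh).
Qed.
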